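(* Let $\mathbf{a}=(a_1,a_2,\dots)$ be a sequence of positive integers such that all the $a_i$ are distinct. Then the $\mathbf{a}$-walk is almost surely transient.
   Context: Let $X_1,X_2,\dots$ be i.i.d. with $P(X_i=1)=P(X_i=-1)=\frac12$. For a non-random sequence $\mathbf{a}=(a_1,a_2,\dots)$ of positive numbers, the $\mathbf{a}$-walk is $S(n)=\sum_{k=1}^n a_kX_k$, $S(0)=0$. For $C\ge 0$, the walk is $C$-recurrent if $\{|S(n)|\le C\}$ occurs for infinitely many $n$. The walk is transient if it is not $C$-recurrent for any $C\ge 0$; ''almost surely transient'' means that with probability one, for every $C\ge0$, $|S(n)|\le C$ holds for only finitely many $n$. *)

(* Defs.v *)
From HB Require Import structures.
From mathcomp Require Export all_boot all_order all_algebra finmap.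
From mathcomp Require Export all_classical all_reals all_analysis.

Set Implicit Arguments.
Unset Strict Implicit.
Unset Printing Implicit Defensive.

Export Order.TTheory GRing.Theory Num.Theory.
Export numFieldNormedType.Exports.
Open Scope classical_set_scope.
Open Scope ring_scope.

(* Mutual independence: the product rule over every finite subfamily. *)
Definition independent_RVs (d : measure_display) (T : measurableType d)
    (R : realType) (P : probability T R) (I : choiceType)
    (X : I -> {RV P >-> R}) : Prop :=
  forall (J : {fset I}) (B : I -> set R),
    (forall i, i \in J -> measurable (B i)) ->
    P (\bigcap_(i in [set` J]) (X i @^-1` B i)) =
    (\prod_(i <- J) P (X i @^-1` B i))%E.

(* The two atoms carry all the mass, so this determines the distribution. *)
Definition rademacher (d : measure_display) (T : measurableType d)
    (R : realType) (P : probability T R) (X : {RV P >-> R}) : Prop :=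
  P (X @^-1` [set 1]) = (2^-1)%:E /\ P (X @^-1` [set -1]) = (2^-1)%:E.

(* Sequences are indexed from 0: [a k] and [X k] stand for $a_{k+1}$ and
   $X_{k+1}$, so that [walk a X n w] is $S(n) = a_1 X_1 + ... + a_n X_n$
   at the sample point [w]. *)
Definition walk (d : measure_display) (T : measurableType d)
    (R : realType) (P : probability T R) (a : nat -> R)
    (X : nat -> {RV P >-> R}) (n : nat) (w : T) : R :=
  \sum_(k < n) a k * X k w.

(* Recurrence and transience are properties of a trajectory [s]. *)
Definition recurrent (R : realType) (C : R) (s : nat -> R) : Prop :=
  infinite_set [set n | `|s n| <= C].

Definition transient (R : realType) (s : nat -> R) : Prop :=
  forall C : R, 0 <= C -> ~ recurrent C s.

(* Main.v *)
Require Import Defs.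
From mathcomp Require Import zify ring lra.

(** The walk is at a point of [-C, C] at time n only if the set A of the
    indices with sign +1 has a subset sum, sum_(i in A) a_i, among at most
    2C + 1 values.  So everything rests on an anti-concentration bound for
    subset sums of distinct positive integers, strong enough to be summable
    over n.  The argument is in the spirit of Erdos and Moser, and the bound is
    [subset_sum_concentration]: if
    n >= 32^k, then at most 2^(n+10) / 64^k subsets have a given sum, that is,
    a proportion of order n^-(6/5).

    The proof of that bound first passes to a subset D of the indices:
    conditioning on the signs outside D can only increase the maximal
    proportion ([sum_fiber_extend]).  A greedy choice ([block_or_gapped]) finds
    a D of one of two kinds.

    - D has 2^k elements and each a_i is at least twice the previous one.  Then
      all subset sums of D are distinct ([gapped_fiber]), and the proportion
      is 2^-(2^k), which is tiny.

    - D has m = 16^k elements and all a_i, i in D, lie in some [M, 2M).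
      Let N be the number of subsets of D with sum s, and consider the sets
      obtained from these by deleting one element.  Deleting i gives the sum
      s - a_i, so as the a_i are distinct, a set obtained in this way
      determines i.  All these sums lie in a half-open interval of length M,
      while elements are at least M, so the sets obtained form an antichain.
      The same is true for adding one element.  There are m ways in total to
      delete or to add, so Sperner's theorem gives
      m N <= 2 binomial(m, m/2), of order 2^m / sqrt m ([block_fiber]).

    For the walk, the times are cut into blocks [32^k, 32^(k+1)).  A union
    bound in such a block gives probability O(32^k / 64^k) = O(2^-k) for a
    visit to [-C, C] ([prob_near_origin_block]), and the Borel-Cantelli lemma
    concludes. *)

Set Implicit Arguments.
Unset Strict Implicit.
Unset Printing Implicit Defensive.

(** * Antichains of finite sets *)

Section Antichain.
Import fintype mathcomp.boot.finset.
Local Open Scope set_scope.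
Variable T : finType.
Implicit Types (A B D : {set T}) (F : {set {set T}}).

Definition antichain F := {in F &, forall A B, A \subset B -> A = B}.

Lemma antichainS F F' : F' \subset F -> antichain F -> antichain F'.
Proof. by move=> /subsetP sF aF A B /sF FA /sF FB; apply: aF. Qed.

Lemma antichain_top D F : F \subset powerset D -> antichain F -> D \in F ->
  F = [set D].
Proof.
move=> sFD aF FD; apply/eqP; rewrite eqEsubset sub1set FD andbT.
apply/subsetP=> A FA; rewrite inE (aF A D) //.
by have := subsetP sFD A FA; rewrite inE.
Qed.

(** The Lubell-Yamamoto-Meshalkin inequality, by averaging over the choice of
    an element i of D: the members of F avoiding i form an antichain in D \ {i},
    and for D of size n + 1, the identity
    (n + 1 - k) / binomial(n, k) = (n + 1) / binomial(n + 1, k)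
    says that the average of the n + 1 sums so obtained, each at most 1 by
    induction, is the sum for D.  The identity breaks down at k = n + 1, but if
    D itself belongs to F then F = {D}. *)
Lemma lym_inequality D F : F \subset powerset D -> antichain F ->
  \sum_(A in F) ('C(#|D|, #|A|)%:R : rat)^-1 <= 1.
Proof.
move En: #|D| => n; elim: n D En F => [|n IHn] D cardD F sFD aF.
all: have [FD | FnD] := boolP (D \in F);
  first by rewrite (antichain_top sFD) // big_set1 cardD binn invr1.
  rewrite big1 ?ler01 // => A FA; case/negP: FnD; have := subsetP sFD A FA.
  rewrite inE; have -> : D = set0 by apply/eqP; rewrite -cards_eq0 cardD.
  by rewrite subset0 => /eqP <-.
have n1_gt0 : 0 < n.+1%:R :> rat by rewrite ltr0n.
rewrite -(ler_pM2l n1_gt0) mulr1 mulr_sumr.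
have -> : \sum_(A in F) n.+1%:R * ('C(n.+1, #|A|)%:R : rat)^-1
        = \sum_(A in F) \sum_(i in D | i \notin A) ('C(n, #|A|)%:R : rat)^-1.
  apply: eq_bigr => A FA.
  have sAD : A \subset D by have := subsetP sFD A FA; rewrite inE.
  have ltAn : (#|A| < n.+1)%N.
    rewrite -cardD; apply: proper_card; rewrite properEneq sAD andbT.
    by apply: contra FnD => /eqP <-.
  rewrite sumr_const.
  have -> : #|[pred i in D | i \notin A]| = (n.+1 - #|A|)%N.
    rewrite -cardD -(cardsDS sAD) cardsE; apply: eq_card => i.
    by rewrite !inE andbC.
  have bin0n k : (k >= #|A|)%N -> 'C(k, #|A|)%:R != 0 :> rat.
    by move=> leAk; rewrite pnatr_eq0 -lt0n bin_gt0.
  apply: (mulIf (bin0n n.+1 (ltnW ltAn))); apply: (mulIf (bin0n n ltAn)).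
  rewrite divfK ?bin0n 1?ltnW // -[_^-1 *+ _]mulr_natr [RHS]mulrC -mulrA.
  by rewrite mulVKf ?bin0n // -!natrM mul_bin_down.
rewrite (exchange_big_dep (mem D)) /=; last by move=> A i _ /andP[].
rewrite -[X in _ <= X%:R]cardD -sum1_card natr_sum; apply: ler_sum => i Di.
set F' := [set A in F | i \notin A].
rewrite Di (eq_bigl [in F']) => [|A]; last by rewrite !inE.
apply: (IHn (D :\ i)).
- by have := cardsD1 i D; rewrite Di cardD => -[].
- apply/subsetP=> A; rewrite !inE => /andP[FA iA].
  by rewrite subsetD1 iA andbT; have := subsetP sFD A FA; rewrite inE.
- by apply: antichainS aF; apply/subsetP=> A; rewrite inE => /andP[].
Qed.

Lemma sperner D F K : F \subset powerset D -> antichain F ->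
  (forall k, 'C(#|D|, k) <= K)%N -> (#|F| <= K)%N.
Proof.
move=> sFD aF leK.
have K_gt0 : (0 < K)%N by rewrite (leq_trans _ (leK 0%N)) ?bin0.
rewrite -(ler_nat rat) -[leRHS]mul1r -ler_pdivrMr ?ltr0n //.
apply: le_trans (lym_inequality sFD aF); rewrite mulrC mulr_natr -sumr_const.
apply: ler_sum => A FA.
have sAD : A \subset D by have := subsetP sFD A FA; rewrite inE.
have binA : (0 < 'C(#|D|, #|A|))%N by rewrite bin_gt0 subset_leq_card.
by rewrite lef_pV2 ?posrE ?ltr0n // ler_nat.
Qed.

End Antichain.

(** * Fibers of the subset-sum map *)

Section SubsetSums.
Import fintype mathcomp.boot.finset.
Local Open Scope set_scope.
Local Open Scope nat_scope.
Variables (T : finType) (b : T -> nat).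
Implicit Types (A B D E : {set T}).

Definition sum_fiber D (s : nat) : {set {set T}} :=
  [set A in powerset D | \sum_(i in A) b i == s].

Lemma sum_setD A B : A \subset B ->
  \sum_(i in B) b i = \sum_(i in A) b i + \sum_(i in B :\: A) b i.
Proof.
move=> sAB; rewrite (big_setID A) /=; congr (_ + _).
by apply: eq_bigl => i; rewrite (setIidPr sAB).
Qed.

(** Once the part of A outside D is chosen, the part inside has a prescribed
    sum. *)
Lemma sum_fiber_extend D K s : (forall s', #|sum_fiber D s'| <= K) ->
  #|sum_fiber [set: T] s| <= K * 2 ^ #|~: D|.
Proof.
move=> leK; rewrite -card_powerset mulnC -sum_nat_const -sum1_card.
rewrite (partition_big (fun A => A :\: D) (mem (powerset (~: D)))) /=; last first.
  by move=> A _; rewrite inE setDE subsetIr.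
apply: leq_sum => B; rewrite inE => sB.
apply: leq_trans (leK (s - \sum_(i in B) b i)).
rewrite sum1dep_card -(card_in_imset (f := fun A => A :&: D)); last first.
  move=> A A'; rewrite !inE => /andP[_ /eqP eA] /andP[_ /eqP eA'] eI.
  by rewrite -(setID A D) eA eI -eA' setID.
apply/subset_leq_card/subsetP=> _ /imsetP[A + ->].
rewrite !inE => /andP[/andP[_ /eqP <-] /eqP <-].
by rewrite subsetIr [X in _ == X - _](big_setID D) /= addnK.
Qed.

(** Distinct subset sums of D differ by at least M.  A quantitative form of
    injectivity is needed so that a new smallest element can be inserted
    ([gapped_setU1]). *)
Definition gapped M D := forall A B, A \subset D -> B \subset D -> A != B ->
  \sum_(i in A) b i <= \sum_(i in B) b i ->
  \sum_(i in A) b i + M <= \sum_(i in B) b i.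

Lemma gapped_fiber M D s : 0 < M -> gapped M D -> #|sum_fiber D s| <= 1.
Proof.
move=> M0 gD; apply/card_le1_eqP => A B; rewrite !inE.
move=> /andP[sA /eqP eA] /andP[sB /eqP eB]; apply/eqP; apply/negPn/negP=> AB.
by have := gD B A sB sA AB; rewrite eA eB; lia.
Qed.

(** The new element shifts a difference of sums by at most b i, which leaves at
    least b i of a gap 2 b i; sets that differ only in i have sums that differ
    by b i. *)
Lemma gapped_setU1 i D : gapped (2 * b i) D -> i \notin D ->
  gapped (b i) (i |: D).
Proof.
move=> gD iD A B sA sB neAB.
have sumD1 (C : {set T}) :
    \sum_(j in C) b j = (i \in C) * b i + \sum_(j in C :\ i) b j.
  have [iC | iC] := boolP (i \in C); first by rewrite (big_setD1 i) //= mul1n.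
  rewrite mul0n add0n; apply: eq_bigl => j; rewrite !inE.
  by case: eqP => // ->; apply/negbTE.
have sA' : A :\ i \subset D by rewrite subDset.
have sB' : B :\ i \subset D by rewrite subDset.
rewrite (sumD1 A) (sumD1 B).
have [eAB | /[dup] neAB' /[1!eq_sym] neBA'] := eqVneq (A :\ i) (B :\ i).
  have : (i \in A) != (i \in B).
    apply: contra neAB => /eqP e; apply/eqP/setP=> j.
    have [-> // | ji] := eqVneq j i.
    by move/setP/(_ j): eAB; rewrite !inE ji.
  by rewrite eAB; do 2 case: (i \in _) => //; lia.
have := gD _ _ sA' sB' neAB'; have := gD _ _ sB' sA' neBA'.
by do 2 case: (i \in _); lia.
Qed.

(** Greedy choice: take i with b i minimal.  If fewer than m values lie in
    [b i, 2 b i), discard those; what remains has all values at least 2 b i,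
    and i can be added to the set found there.  The gap of D is only bounded
    below by lower bounds M for b on E, which is the form that the induction
    passes on. *)
Lemma block_or_gapped m r E : 0 < m -> (forall i, 0 < b i) -> r * m <= #|E| ->
  (exists M, m <= #|[set i in E | M <= b i < 2 * M]|) \/
  (exists D, [/\ D \subset E, #|D| = r &
     forall M, (forall i, i \in E -> M <= b i) -> gapped M D]).
Proof.
move=> m_gt0 b_gt0; elim: r E => [|r IHr] E leE.
  right; exists set0; split; rewrite ?sub0set ?cards0 // => M _ A B.
  by rewrite !subset0 => /eqP -> /eqP ->; rewrite eqxx.
have /card_gt0P[i1 Ei1] : 0 < #|E| by lia.
case: (arg_minnP b Ei1) => i Ei min_i; have {}Ei : i \in E by [].
have [block | small_block] := leqP m #|[set j in E | b i <= b j < 2 * b i]|.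
  by left; exists (b i).
pose E' := [set j in E | 2 * b i <= b j].
have cardE : #|E| = #|[set j in E | b i <= b j < 2 * b i]| + #|E'|.
  rewrite -(cardsID E' E) addnC; congr (_ + _); apply: eq_card => j.
    by rewrite !inE; have [/min_i|] := boolP (j \in E); lia.
  by rewrite !inE; have [/min_i|] := boolP (j \in E); lia.
have {}sE'E : E' \subset E by apply/subsetP=> j; rewrite inE => /andP[].
case: (IHr E'); first by rewrite mulSn in leE; lia.
- case=> M leM; left; exists M; apply: leq_trans leM _.
  by apply/subset_leq_card/subsetP=> j; rewrite !inE => /andP[/andP[-> _] ->].
- case=> D [sDE' cardD gD]; right; exists (i |: D).
  have iD : i \notin D.
    by apply/negP=> /(subsetP sDE'); rewrite inE; have := b_gt0 i; lia.
  split; first by rewrite subUset sub1set Ei (subset_trans sDE').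
    by rewrite cardsU1 iD cardD.
  move=> M leM A B sA sB AB leAB.
  apply: leq_trans (gapped_setU1 (gD _ _) iD sA sB AB leAB).
    by rewrite leq_add2l leM.
  by move=> j; rewrite inE => /andP[].
Qed.

(** If A is a proper subset of B, the sum over B exceeds that over A by at least
    M, so the two sums are not in the same half-open interval of length M. *)
Lemma window_antichain M D x (F : {set {set T}}) :
  (forall i, i \in D -> M <= b i) ->
  F \subset powerset D ->
  (forall A, A \in F -> x <= \sum_(i in A) b i < x + M) -> antichain F.
Proof.
move=> leM sF win A B FA FB sAB; apply/eqP; rewrite eqEsubset sAB /=.
apply/subsetP=> i Bi; apply/negPn/negP=> Ai.
have sBD : B \subset D by have := subsetP sF B FB; rewrite inE.
have := win A FA; have := win B FB; have := leM i (subsetP sBD i Bi).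
rewrite (sum_setD sAB) [in X in _ <= X < _](big_setD1 i (A := B :\: A)).
  by move=> /=; lia.
by rewrite inE Ai.
Qed.

(** Here f p is the set obtained from the set p.1 by deleting or adding the
    element p.2. *)
Lemma card_window_pairs M D x K (P : {set {set T} * T})
    (f : {set T} * T -> {set T}) :
  (forall i, i \in D -> M <= b i) -> (forall k, 'C(#|D|, k) <= K) ->
  {in P &, injective f} ->
  (forall p, p \in P ->
     (f p \subset D) && (x <= \sum_(i in f p) b i < x + M)) ->
  \sum_(p in P) 1 <= K.
Proof.
move=> leM leK injf fP; rewrite sum1_card -(card_in_imset injf).
have sF : f @: P \subset powerset D.
  by apply/subsetP=> _ /imsetP[p /fP/andP[sfp _] ->]; rewrite inE.
apply: (sperner sF) leK; apply: (window_antichain leM sF).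
by move=> _ /imsetP[p /fP/andP[_ win] ->]; exact: win.
Qed.

(** A double count of the pairs (A, i) with A in the fiber and i in D: those
    with i in A are counted through A \ {i}, the others through A with i added.
    Counting both kinds makes the number of pairs exactly #|D| times the size of
    the fiber, whatever the sizes of the sets A. *)
Lemma block_fiber M D s K : {in D &, injective b} ->
  (forall i, i \in D -> M <= b i < 2 * M) -> (forall k, 'C(#|D|, k) <= K) ->
  #|D| * #|sum_fiber D s| <= 2 * K.
Proof.
move=> injb bM leK; rewrite mulnC.
have leM i : i \in D -> M <= b i by move/bM/andP=> [].
have sumD1 (A : {set T}) i : i \in A ->
    \sum_(j in A) b j = b i + \sum_(j in A :\ i) b j.
  by move=> Ai; rewrite (big_setD1 i).
have del_le : \sum_(A in sum_fiber D s) \sum_(i in A) 1 <= K.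
  pose P := [set p : {set T} * T | (p.1 \in sum_fiber D s) && (p.2 \in p.1)].
  rewrite pair_big_dep /= (eq_bigl [in P]) => [|p]; last by rewrite /= [RHS]inE.
  have PP A i : (A, i) \in P -> [/\ A \subset D, i \in A, i \in D &
      b i + \sum_(j in A :\ i) b j = s].
    rewrite !inE /= => /andP[/andP[sA /eqP <-] Ai].
    by split=> //; [exact: (subsetP sA) | rewrite -sumD1].
  (* Sums s - b i with M <= b i < 2 M lie in [s + 1 - 2 M, s + 1 - M); the
     truncation at 0 of the lower end is harmless, since s - b i <= s - M. *)
  apply: (@card_window_pairs M D (s.+1 - 2 * M) _ _ (fun p => p.1 :\ p.2)) => //.
    case=> [A i] [A' i'] /PP[_ Ai Di eA] /PP[_ A'i' Di' eA'] /= eAA'.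
    have eii' : i = i' by apply: injb => //; rewrite eAA' in eA; lia.
    by rewrite -(setD1K Ai) -(setD1K A'i') eAA' eii'.
  case=> [A i] /PP[sA Ai Di eA] /=; rewrite subDset subsetU ?sA ?orbT //=.
  by have := bM i Di; lia.
have add_le : \sum_(A in sum_fiber D s) \sum_(i in D :\: A) 1 <= K.
  pose P := [set p : {set T} * T |
               (p.1 \in sum_fiber D s) && (p.2 \in D :\: p.1)].
  rewrite pair_big_dep /= (eq_bigl [in P]) => [|p]; last by rewrite /= [RHS]inE.
  have PP A i : (A, i) \in P -> [/\ A \subset D, i \notin A, i \in D &
      \sum_(j in i |: A) b j = b i + s].
    rewrite !inE /= => /andP[/andP[sA /eqP <-] /andP[Ai Di]].
    by split=> //; rewrite (sumD1 _ i) ?setU11 // setU1K.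
  apply: (@card_window_pairs M D (s + M) _ _ (fun p => p.2 |: p.1)) => //.
    case=> [A i] [A' i'] /PP[_ Ai Di eA] /PP[_ A'i' Di' eA'] /= eAA'.
    have eii' : i = i' by apply: injb => //; rewrite eAA' in eA; lia.
    by rewrite -(setU1K Ai) -(setU1K A'i') eAA' eii'.
  case=> [A i] /PP[sA Ai Di eA] /=; rewrite subUset sub1set Di sA eA /=.
  by have := bM i Di; lia.
rewrite -sum_nat_const mul2n -addnn; apply: leq_trans (leq_add del_le add_le).
rewrite -big_split; apply: leq_sum => A; rewrite inE => /andP[].
by rewrite inE => sA _; rewrite !sum1_card -(cardsID A D) (setIidPr sA).
Qed.

End SubsetSums.

(** * Numerical bounds *)

Section Bounds.
Local Open Scope nat_scope.

(** The square root in the usual bound binomial(2h, h) <= 4^h / sqrt (2h + 1) is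
    removed by squaring; the induction step is
    (2h + 1)(2h + 3) <= 4 (h + 1)^2. *)
Lemma central_bin_sqr h : 'C(h.*2, h) ^ 2 * h.*2.+1 <= 2 ^ (h.*2).*2.
Proof.
elim: h => [|h IHh] //; set c := 'C(h.*2, h) in IHh *; set c' := 'C(_, _).
have c'E : h.+1 * c' = 2 * h.*2.+1 * c.
  have /= e1 := mul_bin_diag h.*2.+2 h; have /= e2 := mul_bin_down h.*2.+1 h.
  rewrite -/c in e2; rewrite -doubleS -/c' in e1.
  apply/eqP; rewrite -(eqn_pmul2l (ltn0Sn h)) -e1; apply/eqP; nia.
have -> : 2 ^ (h.+1.*2).*2 = 16 * 2 ^ (h.*2).*2.
  by rewrite !doubleS !expnS; lia.
rewrite -(leq_pmul2l (expn_gt0 h.+1 2)) mulnA -expnMn c'E.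
set X := 2 ^ _ in IHh *.
have le4 : 4 * h.*2.+1 * h.+1.*2.+1 <= 16 * h.+1 ^ 2 by nia.
have := leq_mul IHh le4; nia.
Qed.

Lemma leq_bin_central h k : 'C(h.*2, k) <= 'C(h.*2, h).
Proof.
have up d : d <= h -> 'C(h.*2, h - d) <= 'C(h.*2, h).
  elim: d => [|d IHd] ltdh; first by rewrite subn0.
  apply: leq_trans (IHd (ltnW ltdh)); have := mul_bin_left h.*2 (h - d.+1).
  rewrite (subnSK ltdh); have : 0 < h - d by lia.
  by move=> hd0 e; rewrite -(leq_pmul2l hd0) e leq_mul2r; lia.
have [lekh | ltkh] := leqP k h; first by rewrite -(subKn lekh) up ?leq_subr.
have [lek2h | lt2hk] := leqP k h.*2; last by rewrite bin_small.
by rewrite -(bin_sub lek2h) (_ : h.*2 - k = h - (k - h)) ?up; lia.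
Qed.

(** Sizes m = 4^j are used because the factor sqrt m = 2^j is an integer. *)
Lemma bin_le_expn j k : 'C(2 ^ j.*2, k) * 2 ^ j <= 2 ^ (2 ^ j.*2).
Proof.
case: j => [|j]; first by case: k => [|[|k]] //; rewrite bin_small.
set h := 2 ^ j.*2.+1; have -> : 2 ^ j.+1.*2 = h.*2.
  by rewrite doubleS expnS mul2n.
apply: leq_trans (leq_mul (leq_bin_central h k) (leqnn _)) _.
rewrite -leq_sqr expnMn -!expnM !muln2; apply: leq_trans (central_bin_sqr h).
by rewrite leq_mul2l orbC doubleS expnS mul2n ltnW.
Qed.

(** Compares 2^-(2^k), the proportion for a gapped set, with 64^-k; the constant
    10 comes from k = 3 and is what the factor 2^10 below absorbs. *)
Lemma leq6k_exp2 k : 6 * k <= 2 ^ k + 10.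
Proof.
do 5 (case: k => [|k] //); elim: k => [|k IHk] //.
have k_gt0 : 0 < 2 ^ k by rewrite expn_gt0.
have e6 : 6 <= 2 ^ k.+1.+4 by rewrite !expnS; lia.
by rewrite expnS; lia.
Qed.

End Bounds.

(** * Concentration of subset sums *)

Section Concentration.
Import fintype mathcomp.boot.finset.
Local Open Scope nat_scope.
Variables (T : finType) (b : T -> nat).

Lemma subset_of_card (D : {set T}) m : m <= #|D| ->
  exists2 D' : {set T}, D' \subset D & #|D'| = m.
Proof.
move=> lemD; exists [set i in take m (enum D)]%SET.
  by apply/subsetP=> i; rewrite inE => /mem_take; rewrite mem_enum.
rewrite cardsE; have /card_uniqP -> := take_uniq m (enum_uniq D).
by rewrite size_takel // -cardE.
Qed.

(** With 32^k = 2^k * 16^k, there is either a block of m = 16^k elements or a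
    gapped set of 2^k elements.  In the block, the proportion is at most
    2 / (m sqrt m) = 2 / 64^k, since m^3 = 64^(2k). *)
Lemma subset_sum_concentration (k s : nat) :
  injective b -> (forall i, 0 < b i) -> 32 ^ k <= #|T| ->
  #|sum_fiber b [set: T]%SET s| * 64 ^ k <= 2 ^ (#|T| + 10).
Proof.
move=> injb b_gt0 leT.
have e64 : 64 ^ k = 2 ^ (6 * k) by rewrite -[64]/(2 ^ 6) -expnM.
suff [D leD] : exists D, forall s',
    #|sum_fiber b D s'| * 64 ^ k <= 2 ^ (#|D| + 10).
  pose K := 2 ^ (#|D| + 10) %/ 64 ^ k.
  have leK s' : #|sum_fiber b D s'| <= K by rewrite leq_divRL ?expn_gt0.
  apply: leq_trans (leq_mul (sum_fiber_extend s leK) (leqnn _)) _.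
  rewrite mulnAC; apply: leq_trans (leq_mul (leq_trunc_div _ _) (leqnn _)) _.
  by rewrite -expnD leq_exp2l // -(cardsC D); lia.
have m_gt0 : 0 < 16 ^ k by rewrite expn_gt0.
have leE : 2 ^ k * 16 ^ k <= #|[set: T]%SET| by rewrite -expnMn cardsT.
have [[M] | [D [_ cardD gD]]] := block_or_gapped m_gt0 b_gt0 leE.
- case/subset_of_card=> D /subsetP sD cardD; exists D => s'; rewrite cardD.
  have cardD2 : #|D| = 2 ^ (k.*2).*2.
    by rewrite cardD -[16]/(2 ^ 4) -expnM; congr (2 ^ _); lia.
  have leD : #|D| * #|sum_fiber b D s'| <= 2 * (2 ^ #|D| %/ 2 ^ k.*2).
    apply: (block_fiber (M := M)) => [i j _ _ /injb //|i /sD|k'].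
      by rewrite inE => /andP[].
    by rewrite cardD2 leq_divRL ?expn_gt0 // bin_le_expn.
  have -> : 64 ^ k = #|D| * 2 ^ k.*2.
    by rewrite cardD -mul2n expnM -expnMn.
  rewrite mulnA (mulnC _ #|D|) -cardD.
  apply: leq_trans (leq_mul leD (leqnn _)) _; rewrite -mulnA.
  apply: leq_trans (leq_mul (leqnn 2) (leq_trunc_div _ _)) _.
  by rewrite -expnS leq_exp2l //; lia.
- exists D => s'; have fiber_le1 := gapped_fiber s' (ltn0Sn 0) (gD 1 _).
  apply: leq_trans (leq_mul (fiber_le1 _) (leqnn _)) _ => //.
  by rewrite mul1n e64 cardD leq_exp2l // leq6k_exp2.
Qed.

(** The signed sum with sign +1 on A and -1 outside A is twice the sum over A
    minus the total; the condition says that it lies in [-C, C]. *)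
Definition near_balanced C : {set {set T}} :=
  [set A : {set T} | (\sum_i b i <= 2 * \sum_(i in A) b i + C) &&
                     (2 * \sum_(i in A) b i <= \sum_i b i + C)]%SET.

(** The signed sum, shifted by C, takes one of the values u = 0, ..., 2C, and
    each u prescribes the sum over A. *)
Lemma card_near_balanced C k : injective b -> (forall i, 0 < b i) ->
  32 ^ k <= #|T| -> #|near_balanced C| * 64 ^ k <= (2 * C).+1 * 2 ^ (#|T| + 10).
Proof.
move=> injb b_gt0 leT; rewrite -sum1_card.
pose v (A : {set T}) : 'I_(2 * C).+1 :=
  inord (2 * \sum_(i in A) b i + C - \sum_i b i).
rewrite (partition_big v predT) //= big_distrl /=.
rewrite -[X in X * 2 ^ _]card_ord -sum_nat_const; apply: leq_sum => u _.
pose s := (u + \sum_i b i - C)./2.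
apply: leq_trans (subset_sum_concentration s injb b_gt0 leT).
rewrite leq_mul2r; apply/orP; right; rewrite sum1dep_card /s.
apply/subset_leq_card/subsetP=> A; rewrite !inE /= subsetT /=.
move=> /andP[/andP[le1 le2] /eqP <-]; apply/eqP; rewrite inordK; last by lia.
by rewrite (_ : _ - C = (\sum_(i in A) b i).*2) ?doubleK //; lia.
Qed.

End Concentration.

(** * Visits of the walk to a neighbourhood of the origin *)

Lemma le_measure_bigsetU d (T : measurableType d) (R : realType)
    (mu : {measure set T -> \bar R}) (I : Type) (r : seq I) (Q : pred I)
    (E : I -> set T) (f : I -> \bar R) :
  (forall i, Q i -> measurable (E i)) -> (forall i, Q i -> (mu (E i) <= f i)%E) ->
  measurable (\big[setU/set0]_(i <- r | Q i) E i) /\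
  (mu (\big[setU/set0]_(i <- r | Q i) E i) <= \sum_(i <- r | Q i) f i)%E.
Proof.
move=> mE lef.
elim/big_rec2: _ => [|i S x Qi [mS leS]]; first by rewrite measure0.
split; first by apply: measurableU => //; exact: mE.
apply: le_trans (leeD (lef i Qi) leS).
by apply: measureU2 => //; exact: mE.
Qed.

Section Walk.
Variables (d : measure_display) (T : measurableType d) (R : realType).
Variables (P : probability T R) (X : nat -> {RV P >-> R}).
Hypothesis X_indep : independent_RVs X.
Hypothesis X_rademacher : forall k, rademacher (X k).

Let measurable_atom k (x : R) : measurable (X k @^-1` [set x]).
Proof. by rewrite -[_ @^-1` _]setTI; exact: measurable_funP. Qed.

Lemma ae_rademacher_pm1 :
  {ae P, forall w, forall k, X k w = 1 \/ X k w = -1}.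
Proof.
apply: ae_foralln => k; have [P1 PN1] := X_rademacher k.
set E := X k @^-1` [set 1] `|` X k @^-1` [set -1].
have mE : measurable E by apply: measurableU.
exists (~` E); split => //; first exact: measurableC.
have PE : P E = ((2^-1)%:E + (2^-1)%:E)%E.
  rewrite -[X in (X + _)%E]P1 -[X in (_ + X)%E]PN1; apply: measureU => //.
  rewrite -preimage_setI -subset0 => w [/= -> /eqP].
  by rewrite -subr_eq0 opprK -mulr2n pnatr_eq0.
by apply: etrans (probability_setC P mE) _; rewrite PE; congr EFin; lra.
Qed.

Definition sign_pattern n (A : {set 'I_n}) (k : nat) : R :=
  if k \in [seq val i | i in A] then 1 else -1.

Definition sign_event n (A : {set 'I_n}) : set T :=
  \bigcap_(k in [set` [fset k in iota 0 n]%fset])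
    X k @^-1` [set sign_pattern A k].

Lemma measurable_sign_event n (A : {set 'I_n}) : measurable (sign_event A).
Proof. by apply: fin_bigcap_measurable. Qed.

Lemma prob_sign_event n (A : {set 'I_n}) : P (sign_event A) = (2^-1 ^+ n)%:E.
Proof.
rewrite /sign_event (X_indep (B := fun k => [set sign_pattern A k])) //.
rewrite (eq_bigr (fun=> (2^-1)%:E)) => [|k _]; last first.
  by have [P1 PN1] := X_rademacher k; rewrite /sign_pattern; case: ifP.
rewrite prodEFin big_const_seq count_predT iter_mulr_1.
by rewrite card_fseq undup_id ?iota_uniq // size_iota.
Qed.

Variables (a : nat -> nat).
Hypotheses (a_gt0 : forall k, (0 < a k)%N) (a_inj : injective a).

(** The event that the signs follow one of the patterns putting the walk in
    [-C, C] at time n.  Off the null set where some X k is not 1 or -1, it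
    contains the event that the walk is there ([near_originP]); being a finite
    union of events of probability 2^-n, it is easier to measure. *)
Definition near_origin n C : set T :=
  \big[setU/set0]_(A in near_balanced (fun i : 'I_n => a i) C) sign_event A.

Lemma near_originP n C w : (forall k, X k w = 1 \/ X k w = -1) ->
  `|walk (fun k => (a k)%:R) X n w| <= C%:R -> near_origin n C w.
Proof.
move=> Xw leC; pose A := [set i : 'I_n | X i w == 1]%SET.
have XE (i : 'I_n) : X i w = if i \in A then 1 else -1.
  by rewrite inE; case: (Xw i) => ->; rewrite ?eqxx // eqNr oner_eq0.
have walkE : walk (fun k => (a k)%:R) X n w + (\sum_(i < n) a i)%:R =
             2 * (\sum_(i in A) a i)%:R.
  rewrite !natr_sum -big_split mulr_sumr [RHS]big_mkcond /=.
  by apply: eq_bigr => i _; rewrite XE; case: ifP => _; ring.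
have A_near : A \in near_balanced (fun i : 'I_n => a i) C.
  move: leC; rewrite inE -!(ler_nat R) 2!natrD natrM ler_norml.
  by move=> /andP[leNC leC]; apply/andP; split; lra.
rewrite /near_origin (bigD1 A) //=; left => k /=.
rewrite !inE mem_iota /= => ltkn; rewrite (XE (Ordinal ltkn)) /sign_pattern.
by rewrite -[k]/(val (Ordinal ltkn)) (mem_map val_inj) mem_enum.
Qed.

Lemma prob_near_origin n C k : (32 ^ k <= n)%N ->
  measurable (near_origin n C) /\
  (P (near_origin n C) <= (((2 * C).+1 * 2 ^ 10)%:R / 64 ^+ k)%:E)%E.
Proof.
move=> lekn.
have [mE leE] := le_measure_bigsetU (mu := P) (index_enum _)
  (fun (A : {set 'I_n}) _ => measurable_sign_event A)
  (fun A (_ : A \in near_balanced (fun i : 'I_n => a i) C) => lexx _).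
split => //; apply: le_trans leE _.
rewrite (eq_bigr (fun=> (2^-1 ^+ n)%:E)) => [|A _]; last exact: prob_sign_event.
rewrite sumEFin lee_fin sumr_const.
have := card_near_balanced C (k := k) (b := fun i : 'I_n => a i).
rewrite card_ord => /(_ _ (fun i => a_gt0 i) lekn) leN.
rewrite ler_pdivlMr ?exprn_gt0 ?ltr0n // -[_ ^+ n *+ _]mulr_natr exprVn.
rewrite -mulrA mulrC ler_pdivrMr ?exprn_gt0 ?ltr0n //.
rewrite -!natrX -!natrM ler_nat.
rewrite -mulnA -expnD addnC; apply: leN.
by move=> i j /a_inj /val_inj.
Qed.

Definition near_origin_block C k : set T :=
  \big[setU/set0]_(n < 32 ^ k.+1 | (32 ^ k <= n)%N) near_origin n C.

(** At most 32^(k+1) times in the block, each of probability at most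
    (2C + 1) 2^10 / 64^k.  The bound is written with 2^(k+1) to be a term of the
    geometric series of ratio 1/2 that has sum 32 (2C + 1) 2^11. *)
Lemma prob_near_origin_block C k :
  measurable (near_origin_block C k) /\
  (P (near_origin_block C k) <=
     ((32 * ((2 * C).+1 * 2 ^ 11))%:R / (2 ^ (k + 1))%:R)%:E)%E.
Proof.
have mE (n : 'I_(32 ^ k.+1)) : (32 ^ k <= n)%N -> measurable (near_origin n C).
  by move=> /(prob_near_origin C)[].
have leE (n : 'I_(32 ^ k.+1)) : (32 ^ k <= n)%N ->
    (P (near_origin n C) <= (((2 * C).+1 * 2 ^ 10)%:R / 64 ^+ k)%:E)%E.
  by move=> /(prob_near_origin C)[].
have [mG leG] := le_measure_bigsetU (index_enum _) mE leE.
split=> //; apply: le_trans leG _; rewrite sumEFin lee_fin.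
apply: (@le_trans _ _
  (\sum_(n < 32 ^ k.+1) ((2 * C).+1 * 2 ^ 10)%:R / 64 ^+ k)).
  rewrite [leLHS]big_mkcond; apply: ler_sum => n _.
  case: ifP => _; first exact: lexx.
  by rewrite divr_ge0 ?exprn_ge0 ?ler0n.
rewrite sumr_const card_ord -[leLHS]mulr_natl.
rewrite -natrX mulrA ler_pdivrMr ?ltr0n ?expn_gt0 // mulrAC.
rewrite ler_pdivlMr ?ltr0n ?expn_gt0 // -!natrM ler_nat.
rewrite addn1 !expnS -[(64 ^ k)%N]/(((32 * 2) ^ k)%N) expnMn.
set x := (32 ^ k)%N; set y := (2 ^ k)%N; nia.
Qed.

Lemma ae_finitely_many_blocks C :
  {ae P, forall w, ~ lim_sup_set (near_origin_block C) w}.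
Proof.
pose r : R := (32 * ((2 * C).+1 * 2 ^ 11))%:R.
have mG k := (prob_near_origin_block C k).1.
have mL : measurable (lim_sup_set (near_origin_block C)).
  by apply: bigcap_measurable => // n _; exact: bigcup_measurable.
have P0 : P (lim_sup_set (near_origin_block C)) = 0.
  apply: lim_sup_set_cvg0 => //.
  apply: (@le_lt_trans _ _ (\sum_(0 <= k <oo) (r / (2 ^ (k + 1))%:R)%:E)%E).
    apply: lee_nneseries => [k _ _|k _] //.
    exact: (prob_near_origin_block C k).2.
  by rewrite (cvg_lim _ (@cvg_geometric_eseries_half _ r 0)) // ltry.
apply: (negligibleS _ ((negligibleP P mL).2 P0)).
by move=> w /= /contrapT.
Qed.

End Walk.

Theorem theorem4 (d : measure_display) (T : measurableType d) (R : realType)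
    (P : probability T R) (X : nat -> {RV P >-> R})
    (X_indep : independent_RVs X) (X_rademacher : forall k, rademacher (X k))
    (a : nat -> nat) (a_gt0 : forall k, (0 < a k)%N) (a_inj : injective a) :
  {ae P, forall w : T, transient (fun n => walk (fun k => (a k)%:R) X n w)}.
Proof.
have rare :
    {ae P, forall w, forall C, ~ lim_sup_set (near_origin_block X a C) w}.
  by apply: ae_foralln => C; exact: ae_finitely_many_blocks.
apply: filterS2 (ae_rademacher_pm1 X_rademacher) rare => w Xw fin_w C0 C0_ge0.
(* An integer bound C >= C0 leaves countably many bounds to consider. *)
pose C := (Num.truncn C0).+1; apply; apply: contrapT => io_w.
apply: (fin_w C) => K _; apply: contrapT => noK.
apply: io_w; apply: (sub_finite_set _ (finite_II (32 ^ K))) => n /= leC0.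
rewrite ltnNge; apply/negP=> leKn; apply: noK.
have n_gt0 : (0 < n)%N by apply: leq_trans leKn; rewrite expn_gt0.
exists (trunc_log 32 n) => /=; first by rewrite trunc_log_max.
have ltn : (n < 32 ^ (trunc_log 32 n).+1)%N by rewrite trunc_log_ltn.
rewrite /near_origin_block (bigD1 (Ordinal ltn)) /=; last by rewrite trunc_logP.
left; apply: near_originP => //; apply: le_trans leC0 _.
by apply/ltW; rewrite truncnS_gt.
Qed.
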